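(* Let $U^\dagger, K^\dagger \in L^2(\mathbb{R}^2)$ with $U^\dagger\in S_1$, $K^\dagger\in S_2$, and let $f = K^\dagger * U^\dagger$. Let $(u_i,k_i)_{i\ge 0}$ be obtained from the multiscale hierarchical decomposition method with noise-free data $f$, i.e. $$(u_0,k_0)\in \operatorname*{arg\,min}_{u,k\in L^2(\mathbb{R}^2)} \Phi(k,u,f)+\lambda_0J_1(u)+\mu_0J_2(k),$$ and, for $n\in\mathbb{N}_0$, $$(u_{n+1},k_{n+1})\in \operatorname*{arg\,min}_{u,k\in L^2(\mathbb{R}^2)} \Phi(k+K_n,u+U_n,f)+\lambda_{n+1}J_1(u)+\mu_{n+1}J_2(k),$$ where $U_n=\sum_{i=0}^n u_i$ and $K_n=\sum_{i=0}^n k_i$. Assume that $J_1$ and $J_2$ are minimal at $0$ and that there are $C_1,C_2\ge 1$ such that $J_1(v_1-v_2)\le C_1(J_1(v_1)+J_1(v_2))$ and $J_2(h_1-h_2)\le C_2(J_2(h_1)+J_2(h_2))$ for all $v_1,v_2,h_1,h_2\in L^2(\mathbb{R}^2)$. Assume additionally that $J_1(U^\dagger)<\infty$ and $J_2(K^\dagger)<\infty$. If, with $C=\max\{C_1,C_2\}$, the parameters satisfy $\lambda_{n-1}\ge 2C\lambda_n$ and $\mu_{n-1}\ge 2C\mu_n$ for all $n\in\mathbb{N}$, then $\Phi(K_n,U_n,f)$ is decreasing (non-increasing) in $n$ and for all $n\in\mathbb{N}_0$ $$\Phi(K_n,U_n,f)\le \frac{2C\left(\lambda_0J_1(U^\d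agger)+\mu_0J_2(K^\dagger)\right)}{n+1}.$$
   Context: $L^2(\mathbb{R}^2)$ is the space of real-valued square-integrable functions on $\mathbb{R}^2$, and $*$ is convolution. $J_1,J_2:L^2(\mathbb{R}^2)\to\mathbb{R}\cup\{\infty\}$ are proper, lower semicontinuous, convex and non-negative functionals. $(\lambda_n)_{n\in\mathbb{N}_0}$ and $(\mu_n)_{n\in\mathbb{N}_0}$ are decreasing sequences of positive real numbers. $S_1,S_2\subseteq L^2(\mathbb{R}^2)$ are convex sets encoding constraints on image and kernel, respectively. The data fidelity is $$\Phi(K,U,g)=\|g-K*U\|_{L^2}^2+\delta_{S_1}(U)+\delta_{S_2}(K),$$ where $\delta_S(z)=0$ if $z\in S$ and $\delta_S(z)=\infty$ otherwise (and $\|w\|_{L^2}=\infty$ if $w\notin L^2$). The minimizers in the iteration are assumed to exist; any choice of minimizers is allowed. *)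

(* Defs.v *)
From HB Require Import structures.
From mathcomp Require Import all_boot all_order all_algebra.
From mathcomp Require Import all_classical all_reals all_analysis.
From mathcomp Require Import measurable_realfun ess_sup_inf lra.

Set Implicit Arguments.
Unset Strict Implicit.
Unset Printing Implicit Defensive.

Import Order.TTheory GRing.Theory Num.Theory.
Import numFieldNormedType.Exports.

Local Open Scope classical_set_scope.
Local Open Scope ring_scope.
Local Open Scope quotient_scope.

(* MathComp-Analysis has the module [LfunType mu p1] of p-integrable functions,
   but no vector space or norm on its quotient by a.e. equality.  The latter is
   built here as a [normedModType R]. *)
Section Lp.
Context d (T : measurableType d) (R : realType).
Variables (mu : {measure set T -> \bar R}) (p : \bar R) (p1 : (1 <= p)%E).

Definition ae_null : {pred LfunType mu p1} :=
  [pred f : LfunType mu p1 | `[< (f : T -> R) = cst 0 %[ae mu] >]].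

Lemma ae_nullP (f : LfunType mu p1) :
  reflect ((f : T -> R) = cst 0 %[ae mu]) (f \in ae_null).
Proof. exact: asboolP. Qed.

Lemma ae_null_zmod_closed : zmod_closed ae_null.
Proof.
split; first by apply/ae_nullP/aeW.
move=> f g /ae_nullP f0 /ae_nullP g0; apply/ae_nullP.
move: f0 g0; apply: filterS2 => x /= f0 g0 xT.
by rewrite -[LHS]/(f x - g x) f0// g0// subrr.
Qed.

HB.instance Definition _ :=
  GRing.isZmodClosed.Build (LfunType mu p1) ae_null ae_null_zmod_closed.

Definition Lp : Type := Quotient.quot ae_null.

HB.instance Definition _ := GRing.Zmodule.on Lp.
HB.instance Definition _ : EqQuotient _ (Quotient.equiv ae_null) Lp :=
  EqQuotient.on Lp.

Definition Lp_class (f : LfunType mu p1) : Lp := \pi f.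

Definition Lp_fun (u : Lp) : LfunType mu p1 := repr u.

Lemma Lp_funK u : Lp_class (Lp_fun u) = u.
Proof. exact: reprK. Qed.

Lemma Lp_eqP (f g : LfunType mu p1) :
  Lp_class f = Lp_class g <-> (f : T -> R) = g %[ae mu].
Proof.
split=> [/eqmodP/ae_nullP|fg]; last apply/eqmodP/ae_nullP.
  by apply: filterS => x /= + xT => /(_ xT)/eqP; rewrite subr_eq0 => /eqP.
move: fg; apply: filterS => x + xT => /(_ xT) fgx.
by rewrite -[LHS]/(f x - g x) fgx subrr.
Qed.

Lemma Lp_reprP (f : LfunType mu p1) :
  (Lp_fun (Lp_class f) : T -> R) = f %[ae mu].
Proof. by apply/Lp_eqP; rewrite Lp_funK. Qed.

Definition Lp_scale (a : R) (u : Lp) : Lp := Lp_class (a *: Lp_fun u).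

Lemma Lp_classZ a (f : LfunType mu p1) :
  Lp_scale a (Lp_class f) = Lp_class (a *: f).
Proof.
apply/Lp_eqP; have := Lp_reprP f; apply: filterS => x + xT => /(_ xT) fx.
by rewrite -[LHS]/(a * Lp_fun (Lp_class f) x) fx.
Qed.

Lemma Lp_classD (f g : LfunType mu p1) :
  Lp_class (f + g) = Lp_class f + Lp_class g.
Proof. exact: Quotient.pi_add. Qed.

Lemma Lp_class0 : Lp_class 0 = 0.
Proof. by apply: (addrI (Lp_class 0)); rewrite -Lp_classD !addr0. Qed.

Lemma Lp_scaleA a b u : Lp_scale a (Lp_scale b u) = Lp_scale (a * b) u.
Proof. by rewrite -[u]Lp_funK !Lp_classZ scalerA. Qed.

Lemma Lp_scale1 : left_id 1 Lp_scale.
Proof. by move=> u; rewrite -[u]Lp_funK Lp_classZ scale1r. Qed.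

Lemma Lp_scaleDr : right_distributive Lp_scale +%R.
Proof.
move=> a u v; rewrite -[u]Lp_funK -[v]Lp_funK -Lp_classD !Lp_classZ.
by rewrite scalerDr Lp_classD.
Qed.

Lemma Lp_scaleDl u : {morph Lp_scale^~ u : a b / a + b}.
Proof. by move=> a b; rewrite -[u]Lp_funK !Lp_classZ scalerDl Lp_classD. Qed.

HB.instance Definition _ := GRing.Zmodule_isLmodule.Build R Lp
  Lp_scaleA Lp_scale1 Lp_scaleDr Lp_scaleDl.

Lemma ae_eq_fine_Lnorm (f g : LfunType mu p1) : (f : T -> R) = g %[ae mu] ->
  fine 'N[mu]_p[EFin \o f] = fine 'N[mu]_p[EFin \o g].
Proof.
have null_norm (h : LfunType mu p1) : (h : T -> R) = cst 0 %[ae mu] ->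
    fine 'N[mu]_p[EFin \o h] = 0.
  case: p p1 h => [r|//|//] r1 h h0.
    have r0 : r != 0 by rewrite gt_eqF// (lt_le_trans ltr01).
    rewrite unlock /Lnorm (_ : integral mu setT _ = 0%E).
      by rewrite poweR0r ?invr_eq0.
    rewrite -(@integral0 _ _ _ mu setT); apply: ae_eq_integral => //.
      apply/measurable_EFinP; apply: (measurableT_comp (measurable_powR _)).
      exact: measurableT_comp.
    move: h0; apply: filterS => x /= /[apply] ->.
    by rewrite normr0 powR0.
  rewrite unlock /Lnorm; case: ifPn => // mu0.
  rewrite (_ : ess_sup _ _ = 0%E)//; apply: ess_sup_ae_cst => //.
  by move: h0; apply: filterS => x /= /(_ I) ->; rewrite normr0.
have le_norm (h1 h2 : LfunType mu p1) : (h1 : T -> R) = h2 %[ae mu] ->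
    fine 'N[mu]_p[EFin \o h1] <= fine 'N[mu]_p[EFin \o h2].
  move=> h12; have := ler_LnormD (h1 - h2) h2; rewrite subrK.
  rewrite [X in _ <= X + _]null_norm ?add0r//.
  move: h12; apply: filterS => x + xT => /(_ xT) h12x.
  by rewrite -[LHS]/(h1 x - h2 x) h12x subrr.
move=> fg; apply/eqP; rewrite eq_le le_norm//= le_norm//.
by move: fg; apply: filterS => x + xT => /(_ xT).
Qed.

Definition Lp_norm (u : Lp) : R := fine 'N[mu]_p[EFin \o Lp_fun u].

Lemma Lp_norm_class (f : LfunType mu p1) :
  Lp_norm (Lp_class f) = fine 'N[mu]_p[EFin \o f].
Proof. exact/ae_eq_fine_Lnorm/Lp_reprP. Qed.

Lemma ler_Lp_normD u v : Lp_norm (u + v) <= Lp_norm u + Lp_norm v.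
Proof.
by rewrite -[u]Lp_funK -[v]Lp_funK -Lp_classD !Lp_norm_class; exact: ler_LnormD.
Qed.

Lemma Lp_normZ (a : R) (u : Lp) : Lp_norm (a *: u) = `|a| * Lp_norm u.
Proof.
rewrite -[u]Lp_funK [_ *: _]Lp_classZ !Lp_norm_class.
by apply: EFin_inj; rewrite EFinM !finite_norm_fine LnormZ.
Qed.

Lemma Lp_norm_eq0 (u : Lp) : Lp_norm u = 0 -> u = 0.
Proof.
rewrite -[u]Lp_funK Lp_norm_class -Lp_class0 => /fine_Lnormr_eq0 u0.
exact/Lp_eqP.
Qed.

HB.instance Definition _ := Lmodule_isNormed.Build R Lp
  ler_Lp_normD Lp_normZ Lp_norm_eq0.

End Lp.

Section L2_plane.
Context (R : realType).

Local Notation mR := (measurableTypeR R).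

Definition plane_measure : {measure set (mR * mR) -> \bar R} :=
  (@lebesgue_measure R \x @lebesgue_measure R)%E.

Definition L2 : Type := Lp plane_measure (lee1n 2).

HB.instance Definition _ := NormedModule.on L2.

(* The convolution of two elements of [L2] is defined at every point (the
   integrand is integrable by Hoelder) but need not be square-integrable, so it
   is a function on the plane. *)
Definition convolution (f g : R * R -> R) (x : R * R) : R :=
  \int[plane_measure]_y (f (x - y) * g y).

Lemma lebesgue_measure_subl (c : R) (A : set R) : measurable A ->
  lebesgue_measure ((fun y : measurableTypeR R => c - y) @^-1` A) =
  lebesgue_measure A.
Proof.
move=> mA; apply/esym.
pose h : measurableTypeR R -> measurableTypeR R := fun y : R => c - y.
have mh : measurable_fun setT h by exact: measurable_funB.
apply: (lebesgue_measure_unique (mu := pushforward lebesgue_measure h)) => //.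
move=> _ [[a b]] _ <-; rewrite /pushforward /=.
rewrite [X in _ = lebesgue_measure X](_ : _ = `[c - b, c - a[%classic).
  rewrite !lebesgue_measure_itv /= !lte_fin.
  rewrite (_ : (c - b < c - a) = (a < b)); last by apply/idP/idP => ?; lra.
  by case: ifP => // _; rewrite -!EFinB; congr EFin; lra.
apply/seteqP; split=> y; rewrite /h /= !in_itv /=.
  by move=> /andP[? ?]; apply/andP; split; lra.
by move=> /andP[? ?]; apply/andP; split; lra.
Qed.

Lemma measurable_plane_subl (c : R * R) :
  measurable_fun setT ((fun y : R * R => c - y) : mR * mR -> mR * mR).
Proof.
apply/measurable_fun_pairP; split => /=.
  exact: (measurable_funB (f := cst c.1) (g := fst)).
exact: (measurable_funB (f := cst c.2) (g := snd)).
Qed.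

Lemma plane_measure_subl (c : R * R) (A : set (mR * mR)) : measurable A ->
  plane_measure ((fun y : R * R => c - y) @^-1` A) = plane_measure A.
Proof.
move=> mA; apply/esym.
have mh := measurable_plane_subl c.
pose h : mR * mR -> mR * mR := fun y : R * R => c - y.
pose nu := pushforward plane_measure h.
apply: (product_measure_unique (m' := nu)) => //.
move=> X Y mX mY; rewrite /nu /pushforward.
pose h1 (c1 : R) : mR -> mR := fun y : R => c1 - y.
have mh1 c1 : measurable_fun setT (h1 c1) by exact: measurable_funB.
have hE c1 (Z : set mR) : measurable Z ->
    lebesgue_measure Z = lebesgue_measure (h1 c1 @^-1` Z).
  by move=> mZ; exact/esym/lebesgue_measure_subl.
have mhZ c1 (Z : set mR) : measurable Z -> measurable (h1 c1 @^-1` Z).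
  by move=> mZ; rewrite -[X in measurable X]setTI; exact: mh1.
transitivity (lebesgue_measure (h1 c.1 @^-1` X) *
    lebesgue_measure (h1 c.2 @^-1` Y))%E.
  by rewrite -(product_measure1E _ _ (mhZ c.1 X mX) (mhZ c.2 Y mY)).
by congr (_ * _)%E; exact/esym/hE.
Qed.

(* [convolution] only depends on the classes of its arguments. *)
Lemma convolution_ae (f f' g g' : LfunType plane_measure (lee1n 2)) x :
  (f : R * R -> R) = f' %[ae plane_measure] ->
  (g : R * R -> R) = g' %[ae plane_measure] ->
  convolution f g x = convolution f' g' x.
Proof.
have mint (h1 h2 : LfunType plane_measure (lee1n 2)) :
    measurable_fun setT (fun y : mR * mR => (h1 (x - y : R * R) * h2 y)%:E).
  apply/measurable_EFinP; apply: measurable_funM => //.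
  exact: (measurableT_comp (f := h1) _ (measurable_plane_subl x)).
move=> [A [mA A0 fA]] gg'; congr fine; apply: ae_eq_integral => //.
have ff' : \forall y \ae plane_measure, f (x - y : R * R) = f' (x - y : R * R).
  exists ((fun y : R * R => x - y) @^-1` A); split.
  - by rewrite -[X in measurable X]setTI; exact: measurable_plane_subl.
  - by rewrite -A0; exact: plane_measure_subl.
  - by move=> y /= fy; apply: fA => /(_ I).
move: ff' gg'; apply: filterS2.
  exact: (ae_filter_ringOfSetsType plane_measure).
by move=> y fy gy _; rewrite fy gy.
Qed.

(* The extended L2 norm of an arbitrary function. The test is needed because
   ['N[mu]_2] of a non-measurable function may be finite. *)
Definition L2_enorm (w : R * R -> R) : \bar R :=
  if w \in Lfun plane_measure 2 then 'N[plane_measure]_2[EFin \o w]%E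
  else +oo%E.

Definition indicator (S : set L2) (z : L2) : \bar R :=
  if z \in S then 0%E else +oo%E.

Definition proper_functional (J : L2 -> \bar R) : Prop :=
  (forall v, -oo < J v)%E /\ (exists v, J v < +oo)%E.

(* [0 * +oo = 0] in [\bar R], so nothing is required at [t = 0] and [t = 1]. *)
Definition convex_functional (J : L2 -> \bar R) : Prop :=
  forall (v w : L2) (t : R), 0 <= t <= 1 ->
    (J (t *: v + (1 - t) *: w)%R <= t%:E * J v + (1 - t)%:E * J w)%E.

Definition is_argmin (A : Type) (E : A -> \bar R) (a : A) : Prop :=
  forall b, (E a <= E b)%E.

Definition fidelity (S1 S2 : set L2) (K U : L2) (g : R * R -> R) : \bar R :=
  (L2_enorm (g \- convolution (Lp_fun K) (Lp_fun U))%R ^+ 2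
   + indicator S1 U + indicator S2 K)%E.

Definition psum (u : nat -> L2) (n : nat) : L2 := \sum_(i < n.+1) u i.

Definition mhdm (S1 S2 : set L2) (J1 J2 : L2 -> \bar R)
    (lambda mu : nat -> R) (g : R * R -> R) (u k : nat -> L2) : Prop :=
  is_argmin (fun uk : L2 * L2 =>
      fidelity S1 S2 uk.2 uk.1 g
      + (lambda 0%N)%:E * J1 uk.1 + (mu 0%N)%:E * J2 uk.2)%E (u 0%N, k 0%N) /\
  forall n, is_argmin (fun uk : L2 * L2 =>
      fidelity S1 S2 (uk.2 + psum k n)%R (uk.1 + psum u n)%R g
      + (lambda n.+1)%:E * J1 uk.1 + (mu n.+1)%:E * J2 uk.2)%E
    (u n.+1, k n.+1).

End L2_plane.

(* Main.v *)
(* Set a_n = lambda_n J1(u_n) + mu_n J2(k_n) and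
   D_n = lambda_n J1(Udag - U_{n-1}) + mu_n J2(Kdag - K_{n-1}), with empty sums
   for n = 0. The competitor (Udag - U_{n-1}, Kdag - K_{n-1}) has zero fidelity,
   so Phi_n + a_n <= D_n, while the quasi-triangle inequality and the decay of
   the parameters give 2 D_{n+1} <= D_n + a_n. Hence
   Phi_n + 2 D_{n+1} <= 2 D_n, which telescopes to
   Phi_0 + ... + Phi_n <= 2 D_0. The competitor (0, 0) shows that Phi is
   nonincreasing, so (n + 1) Phi_n is at most this sum. *)
Require Import Defs.
From mathcomp Require Import all_boot all_order all_algebra.
From mathcomp Require Import all_classical all_reals all_analysis.

Set Implicit Arguments.
Unset Strict Implicit.
Unset Printing Implicit Defensive.

Import Order.TTheory GRing.Theory Num.Theory.
Import numFieldNormedType.Exports.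

Local Open Scope classical_set_scope.
Local Open Scope ring_scope.

Lemma psumS (R : realType) (u : nat -> L2 R) n :
  psum u n.+1 = u n.+1 + psum u n.
Proof. by rewrite /psum big_ord_recr addrC. Qed.

Lemma fidelity_exact (R : realType) (S1 S2 : set (L2 R)) K U :
  S1 U -> S2 K ->
  fidelity S1 S2 K U (convolution (Lp_fun K) (Lp_fun U)) = 0%E.
Proof.
move=> S1U S2K; rewrite /fidelity /indicator !mem_set// !adde0.
rewrite (_ : _ \- _ = 0); last by apply/funext => x /=; rewrite subrr.
(* The zero residual has to pass the membership test in [L2_enorm], whose default value is [+oo]. *)
have Lfun0 : (0 : R * R -> R) \in Lfun (plane_measure R) 2.
  by case: (Lfun_submod_closed (plane_measure R) (lee1n 2)).
rewrite /L2_enorm ifT//.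
by rewrite (_ : EFin \o 0 = cst 0%E)// Lnorm0 ?expe2 ?mule0// gt_eqF.
Qed.

(** The induction keeps the remainder [D n + D n] on the left instead of subtracting it, so infinite
    values do no harm; being nonnegative, it is dropped at the end. *)
Lemma sum_energy_decay (R : realType) (P a D : nat -> \bar R) :
  (forall n, 0 <= D n)%E ->
  (forall n, P n + a n <= D n)%E ->
  (forall n, D n.+1 + D n.+1 <= D n + a n)%E ->
  forall n, (\sum_(i < n) P i <= D 0%N + D 0%N)%E.
Proof.
move=> D0 PaD DD n.
suff: (\sum_(i < n) P i + (D n + D n) <= D 0%N + D 0%N)%E.
  by apply: le_trans; rewrite leeDl// adde_ge0.
elim: n => [|n IHn]; first by rewrite big_ord0 add0e.
apply: le_trans IHn; rewrite big_ord_recr /= -addeA; apply: leeD => //.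
apply: le_trans (leeD (lexx (P n)) (DD n)) _.
by rewrite addeCA; exact: leeD.
Qed.

(** Doubling costs a factor 2 and the quasi-triangle inequality a factor [C]; the drop from [l] to
    [l'] absorbs both. *)
Lemma scaled_quasi_triangle (R : realType) (V : zmodType) (J : V -> \bar R)
    (C : R) (l l' : R) (v w : V) :
  (forall v, 0 <= J v)%E ->
  (forall v w, J (v - w)%R <= C%:E * (J v + J w))%E ->
  0 <= l' -> 2 * C * l' <= l ->
  (l'%:E * J (v - w)%R + l'%:E * J (v - w)%R <= l%:E * J v + l%:E * J w)%E.
Proof.
move=> J0 JC l'0 ll'; rewrite -ge0_muleDl ?lee_fin// -ge0_muleDr//.
apply: (@le_trans _ _ ((2 * C * l')%:E * (J v + J w))%E); last first.
  by apply: lee_wpmul2r; rewrite ?adde_ge0 ?lee_fin.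
rewrite (_ : 2 * C * l' = (l' + l') * C); last first.
  by rewrite mulrAC mulrDl mul1r.
by rewrite EFinM -muleA; apply: lee_wpmul2l; rewrite // lee_fin addr_ge0.
Qed.

Theorem theorem2p1 (R : realType)
    (J1 J2 : L2 R -> \bar R) (S1 S2 : set (L2 R))
    (lambda mu : nat -> R) (Udag Kdag : L2 R) (u k : nat -> L2 R) (C1 C2 : R)
    (J1_ge0 : forall v, (0 <= J1 v)%E) (J2_ge0 : forall h, (0 <= J2 h)%E)
    (J1_proper : proper_functional J1) (J2_proper : proper_functional J2)
    (J1_lsc : lower_semicontinuous J1) (J2_lsc : lower_semicontinuous J2)
    (J1_convex : convex_functional J1) (J2_convex : convex_functional J2)
    (S1_convex : convex_set S1) (S2_convex : convex_set S2)
    (lambda_gt0 : forall n, 0 < lambda n) (mu_gt0 : forall n, 0 < mu n)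
    (lambda_decr : nonincreasing_seq lambda) (mu_decr : nonincreasing_seq mu)
    (Udag_S1 : S1 Udag) (Kdag_S2 : S2 Kdag) :
  let f := convolution (Lp_fun Kdag) (Lp_fun Udag) in
  let Phi n := fidelity S1 S2 (psum k n) (psum u n) f in
  let C := Num.max C1 C2 in
  mhdm S1 S2 J1 J2 lambda mu f u k ->
  is_argmin J1 0 -> is_argmin J2 0 ->
  1 <= C1 -> 1 <= C2 ->
  (forall v1 v2 : L2 R, J1 (v1 - v2)%R <= C1%:E * (J1 v1 + J1 v2))%E ->
  (forall h1 h2 : L2 R, J2 (h1 - h2)%R <= C2%:E * (J2 h1 + J2 h2))%E ->
  (J1 Udag < +oo)%E -> (J2 Kdag < +oo)%E ->
  (forall n, lambda n >= 2 * C * lambda n.+1) ->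
  (forall n, mu n >= 2 * C * mu n.+1) ->
  nonincreasing_seq Phi /\
  forall n, (Phi n <=
    (2 * C)%:E * ((lambda 0%N)%:E * J1 Udag + (mu 0%N)%:E * J2 Kdag)
    * (n.+1%:R^-1)%:E)%E.
Proof.
move=> f Phi C [min0 minS] J1min J2min C1ge1 C2ge1 J1C J2C J1fin J2fin hl hm.
pose a n := ((lambda n)%:E * J1 (u n) + (mu n)%:E * J2 (k n))%E.
pose Dist n := ((lambda n)%:E * J1 (Udag - \sum_(i < n) u i)%R
                + (mu n)%:E * J2 (Kdag - \sum_(i < n) k i)%R)%E.
have lJ_ge0 n v : (0 <= (lambda n)%:E * J1 v)%E.
  by rewrite mule_ge0// lee_fin ltW.
have mJ_ge0 n h : (0 <= (mu n)%:E * J2 h)%E.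
  by rewrite mule_ge0// lee_fin ltW.
have PaD n : (Phi n + a n <= Dist n)%E.
  case: n => [|n]; rewrite /Phi /a /Dist addeA.
    have := min0 (Udag, Kdag) => /=.
    by rewrite fidelity_exact// add0e /psum !big_ord1 !big_ord0 !subr0.
  have := minS n (Udag - psum u n, Kdag - psum k n) => /=.
  by rewrite !subrK fidelity_exact// add0e -!psumS.
(* The decay is assumed for the maximum [C], whereas each functional uses it with its own constant
   [C1] or [C2]. *)
have lam_le (D : R) (nu : nat -> R) n : 0 < nu n.+1 -> D <= C ->
    2 * C * nu n.+1 <= nu n -> 2 * D * nu n.+1 <= nu n.
  move=> nu0 DC; apply: le_trans.
  by rewrite ler_wpM2r ?(ltW nu0)// ler_wpM2l.
have DD n : (Dist n.+1 + Dist n.+1 <= Dist n + a n)%E.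
  (* The new residual is the old one minus the new increment, the form to which the quasi-triangle
     inequality applies. *)
  have subS (x : L2 R) (v : nat -> L2 R) :
      x - \sum_(i < n.+1) v i = x - \sum_(i < n) v i - v n.
    by rewrite big_ord_recr opprD addrA.
  rewrite /Dist /a !subS addeACA [leRHS]addeACA.
  apply: leeD; apply: scaled_quasi_triangle => //.
  - exact: ltW.
  - by apply: lam_le => //; rewrite le_max lexx.
  - exact: ltW.
  - by apply: lam_le => //; rewrite le_max lexx orbT.
have Phi_decr : nonincreasing_seq Phi.
  apply/nonincreasing_seqP => n.
  (* This is the penalty of the zero increment. It is finite because [J1 0 <= J1 Udag] and
     [J2 0 <= J2 Kdag], so it can be cancelled from [Phi n.+1 + b <= Phi n + b]. *)
  pose b := ((lambda n.+1)%:E * J1 0%R + (mu n.+1)%:E * J2 0%R)%E.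
  have b_fin : b \is a fin_num.
    rewrite fin_numD !fin_numM// ge0_fin_numE//.
      exact: le_lt_trans (J2min Kdag) J2fin.
    exact: le_lt_trans (J1min Udag) J1fin.
  have ba : (b <= a n.+1)%E.
    by apply: leeD; apply: lee_wpmul2l; rewrite ?lee_fin ?(ltW (lambda_gt0 _))
      ?(ltW (mu_gt0 _)).
  rewrite -(leeD2rE _ _ b_fin); apply: le_trans (leeD (lexx _) ba) _.
  have := minS n (0, 0) => /=.
  by rewrite !add0r -!psumS -!addeA.
split=> // n.
have D_ge0 m : (0 <= Dist m)%E by exact: adde_ge0.
have D0E : Dist 0%N = ((lambda 0%N)%:E * J1 Udag + (mu 0%N)%:E * J2 Kdag)%E.
  by rewrite /Dist !big_ord0 !subr0.
rewrite -D0E lee_pdivlMr//.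
have C_ge1 : 1 <= C by rewrite le_max C1ge1.
have -> : (Phi n * n.+1%:R%:E = \sum_(i < n.+1) Phi n)%E.
  by rewrite sumr_const card_ord muleC mule_natl.
apply: (@le_trans _ _ (\sum_(i < n.+1) Phi i)%E).
  by apply: lee_sum => i _; apply: Phi_decr; rewrite -ltnS.
apply: le_trans (sum_energy_decay D_ge0 PaD DD n.+1) _.
(* Telescoping gives the factor 2, which is at most [2 * C] since [1 <= C]. *)
rewrite -mule2n -mule_natl; apply: lee_wpmul2r => //.
by rewrite lee_fin ler_peMr.
Qed.
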